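(* Let $\mathcal D$ be a real-label template data distribution in which every template $z\in\mathrm{supp}(\mu_{\mathrm{tmplt}})$ consists only of wildcards ($z\in\mathcal W^k$), and suppose the label function $f_*$ is non-constant on $\mathrm{supp}(\mu_{\mathrm{tmplt}})$. Let $\mathcal X_{uns}$ be as below and assume $|\mathcal X_{uns}|\ge k$. Then for any SGD step $t$ and any step sizes, there is a string $x\in\mathcal X_{uns}^k$ matching some template $z\in\mathrm{supp}(\mu_{\mathrm{tmplt}})$ such that $$\mathbb E_{\theta^t}\big[(f_{\mathrm{MLP}}(x;\theta^t)-f_*(z))^2\big]\ge c>0,$$ where $c$ depends only on $\mu_{\mathrm{tmplt}}$ and $f_*$.
   Context: Let $\mathcal X$ be a finite alphabet of tokens with $m=|\mathcal X|$, and $\mathcal W$ a finite alphabet of wildcards disjoint from $\mathcal X$. A template is a string $z\in(\mathcal X\cup\mathcal W)^k$. A substitution map is an injective function $s:\mathcal W\to\mathcal X$; $\mathrm{sub}(z,s)\in\mathcal X^k$ denotes the string with $i$-th entry $z_i$ if $z_i\in\mathcal X$ and $s(z_i)$ if $z_i\in\mathcal W$. A string $x\in\mathcal X^k$ matches template $z$ if $x=\mathrm{sub}(z,s)$ for some substitution map $s$ with $s(\mathcal W)\cap\{z_1,\dots,z_k\}=\emptyset$. A real-label template data distribution $\mathcal D(\mu_{\mathrm{tmplt}},\{\mu_{sub,z}\}_z,f_*,\sigma)$ is given by a distribution $\mu_{\mathrm{tmplt}}$ on templates, for each $z\in\mathrm{supp}(\mu_{\mathrm{tmplt}})$ a distribution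 $\mu_{sub,z}$ on substitution maps, a label function $f_*:\mathrm{supp}(\mu_{\mathrm{tmplt}})\to\mathbb R$ and a noise level $\sigma\ge 0$; a sample is $(x,y)=(\mathrm{sub}(z,s),f_*(z)+\xi)$ with $z\sim\mu_{\mathrm{tmplt}}$, $s\sim\mu_{sub,z}$, $\xi\sim N(0,\sigma^2)$ independent. $\mathcal X=\mathcal X_{seen}\sqcup\mathcal X_{uns}$, where $\mathcal X_{seen}$ is the smallest set with $x\in\mathcal X_{seen}^k$ almost surely for $(x,y)\sim\mathcal D$. The MLP with depth $L$, width $d$ and differentiable activation $\phi$ has weights $\theta=\{W_1,\dots,W_L,w\}$ with $W_1\in\mathbb R^{d\times km}$, $W_\ell\in\mathbb R^{d\times d}$ ($\ell\ge2$), $w\in\mathbb R^d$, and outputs $f_{\mathrm{MLP}}(x;\theta)=w^Tz_L(x;\theta)$ where $z_0(x)=(e_{x_1},\dots,e_{x_k})\in\mathbb R^{km}$ and $z_\ell(x;\theta)=\phi(W_\ell z_{\ell-1}(x;\theta))$ elementwise. One-pass SGD: $\theta^0$ has independent Gaussian entries, i.i.d. within each of $W_1^0,\dots,W_L^0,w^0$; then $\theta^s=\theta^{s-1}-\eta_s\nabla_\theta(f_{\mathrm{MLP}}(x^s;\theta)-y^s)^2|_{\theta=\theta^{s-1}}$ with fresh independent samples $(x^s,y^s)\sim\mathcal D$ and step sizes $\eta_s>0$. *)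

(* Defs.v *)
From HB Require Import structures.
From mathcomp Require Import all_boot all_order all_algebra.
From mathcomp Require Import all_classical all_reals all_analysis.
Set Implicit Arguments. Unset Strict Implicit. Unset Printing Implicit Defensive.
Import Order.TTheory GRing.Theory Num.Theory.
Local Open Scope classical_set_scope.
Local Open Scope ring_scope.

Section Templates.
Variables (X W : finType) (k : nat).

Definition template := {ffun 'I_k -> (X + W)%type}.
Definition tstring := {ffun 'I_k -> X}.
Definition submap := {ffun W -> X}.

Definition sub (z : template) (s : submap) : tstring :=
  [ffun i => match z i with inl a => a | inr w => s w end].

Definition template_tokens (z : template) : pred X :=
  fun a => [exists i, z i == inl a].

Definition matches (x : tstring) (z : template) : Prop :=
  exists s : submap, injective s /\ (forall w, ~~ template_tokens z (s w)) /\
    x = sub z s.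

Definition all_wildcards (z : template) : Prop :=
  forall i, exists w, z i = inr w.

Variable R : realType.

Definition is_distr (T : finType) (mu : T -> R) : Prop :=
  (forall t, 0 <= mu t) /\ \sum_t mu t = 1.

Definition in_supp (mu : template -> R) (z : template) : Prop := 0 < mu z.

Definition is_sub_distrs (mu : template -> R) (musub : template -> submap -> R)
  : Prop :=
  forall z, in_supp mu z ->
    is_distr (musub z) /\ (forall s, 0 < musub z s -> injective s).

Definition prob_x (mu : template -> R) (musub : template -> submap -> R)
  (x0 : tstring) : R :=
  \sum_z \sum_(s | sub z s == x0) mu z * musub z s.

Definition X_seen (mu : template -> R) (musub : template -> submap -> R)
  : {set X} :=
  [set a | [forall S : {set X},
     (\sum_(x0 : tstring | [forall i, x0 i \in S]) prob_x mu musub x0 == 1)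
       ==> (a \in S)]].

Definition X_uns mu musub : {set X} := ~: X_seen mu musub.

End Templates.

Section MLP.
Variables (R : realType) (X : finType) (k d L : nat).

(* parameter indices: entries of W_1 (rows 'I_d, columns indexed by the
   km coordinates (position, token) of z_0), entries of W_2..W_L
   (hidden layer l : 'I_(L-1) stands for W_(l+2)), entries of w *)
Definition pidx : finType :=
  (('I_d * ('I_k * X)) + ('I_(L.-1) * 'I_d * 'I_d) + 'I_d)%type.

Definition params := pidx -> R.

Definition onehot (x : {ffun 'I_k -> X}) (c : 'I_k * X) : R :=
  if x c.1 == c.2 then 1 else 0.

Definition f_MLP (phi : R -> R) (x : {ffun 'I_k -> X}) (th : params) : R :=
  let z1 : 'I_d -> R :=
    fun i => phi (\sum_(c : 'I_k * X) th (inl (inl (i, c))) * onehot x c) in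
  let zL : 'I_d -> R :=
    foldl (fun (z : 'I_d -> R) (l : 'I_(L.-1)) =>
             fun i => phi (\sum_(j : 'I_d) th (inl (inr (l, i, j))) * z j))
          z1 (enum 'I_(L.-1)) in
  \sum_(i : 'I_d) th (inr i) * zL i.

Definition grad (F : params -> R) (th : params) : params :=
  fun p => derive1 (fun h : R => F (fun q => th q + (if q == p then h else 0))) 0.

(* SGD trajectory: theta^0 = th0, theta^(s+1) = theta^s
   - eta_(s+1) grad (f(x^(s+1);.) - y^(s+1))^2 ; the (s+1)-th sample is
   (xs s, ys s) and the (s+1)-th step size is eta s. *)
Fixpoint sgd (phi : R -> R) (eta : nat -> R) (xs : nat -> {ffun 'I_k -> X})
  (ys : nat -> R) (th0 : params) (t : nat) : params :=
  match t with
  | 0 => th0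
  | t'.+1 =>
      let th := sgd phi eta xs ys th0 t' in
      let g := grad (fun th' => (f_MLP phi (xs t') th' - ys t') ^+ 2) th in
      fun p => th p - eta t' * g p
  end.

Definition param_block (p : pidx) : nat :=
  match p with
  | inl (inl _) => 0
  | inl (inr (l, _, _)) => (nat_of_ord l).+1
  | inr _ => L
  end.

End MLP.

(* Gaussian law N(m, s^2) with standard deviation s >= 0 (point mass if s = 0) *)
Definition gauss_law (R : realType) (m s : R) : set R -> \bar R :=
  if s == 0 then @dirac _ R m R else normal_prob m s.

Section Indep.
Local Open Scope ereal_scope.
Context {dO : measure_display} {Omega : measurableType dO} {R : realType}.
Variable P : probability Omega R.

Definition mutually_independent (I : eqType) (E : I -> set (set Omega)) : Prop :=
  forall (J : seq I) (A : I -> set Omega), uniq J ->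
    (forall i, i \in J -> E i (A i)) ->
    P (\bigcap_(i in [set i | i \in J]) A i) = \prod_(i <- J) P (A i).

Definition events_of_real (Y : Omega -> R) : set (set Omega) :=
  [set A | exists B, measurable B /\ A = Y @^-1` B].

Definition events_of_fin (T : finType) (Y : Omega -> T) : set (set Omega) :=
  [set A | exists S : {set T}, A = [set w | Y w \in S]].
End Indep.

(* Main.v *)
(* The columns of W_1 attached to unseen tokens never enter a training sample,
   so exchanging such tokens is a symmetry of one-pass SGD in law.  Hence the
   outputs of the trained network on any two unseen strings have the same
   distribution, even when the strings match templates with different labels,
   and such a common output cannot be close to both labels:
   (a - b)^2 / 2 <= (y - a)^2 + (y - b)^2. *)

Require Import Defs.
From HB Require Import structures.
From mathcomp Require Import all_boot all_order all_algebra.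
From mathcomp Require Import all_classical all_reals all_analysis.
From mathcomp Require Import measurable_realfun perm ring.
Import Order.TTheory GRing.Theory Num.Theory.
Local Open Scope classical_set_scope.
Local Open Scope ring_scope.

(** * Function classes stable under the operations of the network *)

Section ClosedClasses.
Context {R : realType} {X : finType} {k d L : nat} (phi : R -> R).
Context {T : Type} (K : (T -> R) -> Prop).
Hypothesis K_cst : forall a, K (fun=> a).
Hypothesis K_add : forall f g, K f -> K g -> K (fun t => f t + g t).
Hypothesis K_mul : forall f g, K f -> K g -> K (fun t => f t * g t).
Hypothesis K_phi : forall f, K f -> K (fun t => phi (f t)).

Lemma closed_sum (I : Type) (r : seq I) (F : I -> T -> R) :
  (forall i, K (F i)) -> K (fun t => \sum_(i <- r) F i t).
Proof.
move=> KF; elim: r => [|i r IHr].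
  by rewrite (_ : (fun _ => _) = fun=> 0)//; apply/funext => t; rewrite big_nil.
rewrite (_ : (fun _ => _) = fun t => F i t + \sum_(i <- r) F i t).
  exact: K_add.
by apply/funext => t; rewrite big_cons.
Qed.

(** The output is built from its inputs and weights by finitely many sums, products and applications
    of [phi]. Taking [K] abstract lets one induction over the layers serve both derivability and
    measurability. *)
Lemma f_MLP_closed (x : T -> tstring X k) (th : pidx X k d L -> T -> R) :
  (forall c, K (fun t => onehot R (x t) c)) -> (forall p, K (th p)) ->
  K (fun t => f_MLP phi (x t) (th^~ t)).
Proof.
move=> Kx Kth.
(* The activations [z] are quantified because [foldl] changes its accumulator at each layer. *)
have K_layers r (z : T -> 'I_d -> R) : (forall i, K (z^~ i)) ->
    K (fun t => \sum_(i : 'I_d) th (inr i) t *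
      foldl (fun (z : 'I_d -> R) (l : 'I_(L.-1)) =>
        fun i => phi (\sum_(j : 'I_d) th (inl (inr (l, i, j))) t * z j))
        (z t) r i).
  elim: r z => [|l r IHr] z Kz /=.
    by apply: closed_sum => i; apply: K_mul.
  apply: (IHr (fun t i => phi (\sum_(j : 'I_d) th (inl (inr (l, i, j))) t * z t j))).
  by move=> i; apply: K_phi; apply: closed_sum => j; exact: K_mul.
apply: (K_layers _ (fun t i =>
  phi (\sum_(c : 'I_k * X) th (inl (inl (i, c))) t * onehot R (x t) c))) => i.
by apply: K_phi; apply: closed_sum => c; apply: K_mul.
Qed.

End ClosedClasses.

(** * Derivability in the weights and measurability of the SGD iterates *)

Section Regularity.
Context {R : realType} {X : finType} {k d L : nat} {phi : R -> R}.
Hypothesis phi_derivable : forall x : R, derivable phi x 1.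

Let phi_measurable : measurable_fun setT phi.
Proof.
apply: continuous_measurable_fun => x.
exact/differentiable_continuous/derivable1_diffP.
Qed.

Lemma f_MLP_derivable (x : tstring X k) (th : pidx X k d L -> R -> R) :
  (forall p a, derivable (th p) a 1) ->
  forall a, derivable (fun h => f_MLP phi x (th^~ h)) a 1.
Proof.
move=> dth; pose K (f : R -> R) := forall a, derivable f a 1.
have Kcst a : K (fun=> a) by move=> b; apply: derivable_cst.
have Kadd f g : K f -> K g -> K (fun t => f t + g t).
  by move=> df dg a; apply: derivableD.
have Kmul f g : K f -> K g -> K (fun t => f t * g t).
  by move=> df dg a; apply: derivableM.
have Kphi f : K f -> K (fun t => phi (f t)).
  move=> df a; apply/derivable1_diffP/differentiable_comp.
    exact/derivable1_diffP.
  exact/derivable1_diffP.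
exact: (@f_MLP_closed R X k d L phi R K Kcst Kadd Kmul Kphi (fun=> x) th).
Qed.

Context {dT : measure_display} {T : measurableType dT}.

Lemma f_MLP_measurable (x : T -> tstring X k) (th : pidx X k d L -> T -> R) :
  (forall c, measurable_fun setT (fun w => onehot R (x w) c)) ->
  (forall p, measurable_fun setT (th p)) ->
  measurable_fun setT (fun w => f_MLP phi (x w) (th^~ w)).
Proof.
pose K (f : T -> R) := measurable_fun setT f.
have Kcst a : K (fun=> a) by exact: measurable_cst.
have Kadd f g : K f -> K g -> K (fun t => f t + g t) by exact: measurable_funD.
have Kmul f g : K f -> K g -> K (fun t => f t * g t) by exact: measurable_funM.
have Kphi f : K f -> K (fun t => phi (f t)) by exact: measurableT_comp.
exact: (@f_MLP_closed R X k d L phi T K Kcst Kadd Kmul Kphi x th).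
Qed.

(** The derivative is the pointwise limit of the difference quotients with increments [1 / (n + 1)],
    each measurable in [w]. *)
Lemma derive1_measurable (F : T -> R -> R) (a : R) :
  (forall w, derivable (F w) a 1) ->
  (forall h, measurable_fun setT (F^~ h)) ->
  measurable_fun setT (fun w => derive1 (F w) a).
Proof.
move=> dF mF.
pose u (n : nat) : R := n.+1%:R^-1.
apply: (@measurable_fun_cvg _ _ _ _
  (fun n w => (u n)^-1 * (F w (u n + a) - F w a))).
  by move=> n; apply: measurable_funM => //; apply: measurable_funB.
move=> w _; rewrite derive1E.
have := dF w; rewrite /derivable /derive.
set D := fun h : R => _; move=> /cvgr_dnbhsP /(_ u) Du.
rewrite (_ : (fun n => _) = fun n => D (u n)); last first.
  by apply/funext => n; rewrite /D /= [u n *: _]mulr1.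
apply: Du; split; last exact: cvg_harmonic.
by move=> n; rewrite /u invr_neq0.
Qed.

Lemma grad_loss_measurable (x : T -> tstring X k) (y : T -> R)
    (th : pidx X k d L -> T -> R) :
  (forall c, measurable_fun setT (fun w => onehot R (x w) c)) ->
  measurable_fun setT y -> (forall p, measurable_fun setT (th p)) ->
  forall p, measurable_fun setT
    (fun w => grad (fun th' => (f_MLP phi (x w) th' - y w) ^+ 2) (th^~ w) p).
Proof.
move=> mx my mth p; rewrite /grad.
apply: (@derive1_measurable (fun w h =>
  (f_MLP phi (x w) (fun q => th q w + (if q == p then h else 0)) - y w) ^+ 2)).
  move=> w; pose g h := f_MLP phi (x w)
    (fun q => th q w + (if q == p then h else 0)).
  have dg : derivable (fun h => g h - y w) 0 1.
    apply: (@derivableB _ _ _ g (fun=> y w)); last exact: derivable_cst.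
    apply: (@f_MLP_derivable (x w)
      (fun q h => th q w + (if q == p then h else 0))) => q a.
    apply: (@derivableD _ _ _ (fun=> th q w)); first exact: derivable_cst.
    by case: (q == p); [exact: derivable_id|exact: derivable_cst].
  exact: (@derivableX _ _ (fun h => g h - y w) 2).
move=> h; apply: measurable_funX; apply: measurable_funB => //.
apply: (@f_MLP_measurable _ (fun q w => th q w + (if q == p then h else 0))) => // q.
exact: measurable_funD.
Qed.

Lemma sgd_measurable (eta : nat -> R) (x : nat -> T -> tstring X k)
    (y : nat -> T -> R) (th : pidx X k d L -> T -> R) :
  (forall n c, measurable_fun setT (fun w => onehot R (x n w) c)) ->
  (forall n, measurable_fun setT (y n)) ->
  (forall p, measurable_fun setT (th p)) ->
  forall t p, measurable_fun setT
    (fun w => sgd phi eta (x^~ w) (y^~ w) (th^~ w) t p).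
Proof.
move=> mx my mth; elim=> [|t IHt] p //=.
apply: measurable_funB => //; apply: measurable_funM => //.
exact: (@grad_loss_measurable (x t) (y t)
  (fun q w => sgd phi eta (x^~ w) (y^~ w) (th^~ w) t q)).
Qed.

End Regularity.

(** * Equivariance of SGD under permutations of the tokens *)

Section Relabelling.
Context {R : realType} {X : finType} {k d L : nat}.
Variable tau : 'I_k -> {perm X}.

(** Precomposition with this map permutes the columns of [W_1] inside the block of each position;
    the permutation may vary with the position. *)
Definition relabel_params (p : pidx X k d L) : pidx X k d L :=
  match p with
  | inl (inl (i, (j, a))) => inl (inl (i, (j, tau j a)))
  | _ => p
  end.

Definition relabel_string (x : tstring X k) : tstring X k :=
  [ffun j => tau j (x j)].

Lemma relabel_params_inj : injective relabel_params.
Proof.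
case=> [[[i [j a]]|[[l i] j]]|i] [[[i' [j' a']]|[[l' i'] j']]|i'] //=.
by move=> [-> jj']; move: jj' => -> /perm_inj ->.
Qed.

Lemma relabel_params_block p : param_block (relabel_params p) = param_block p.
Proof. by case: p => [[[i [j a]]|[[l i] j]]|i]. Qed.

(** Reindexing the first-layer sum over columns moves the permutation from the weights to the
    one-hot input. *)
Lemma f_MLP_relabel (phi : R -> R) x (th : params R X k d L) :
  f_MLP phi x (th \o relabel_params) = f_MLP phi (relabel_string x) th.
Proof.
rewrite /f_MLP /=; apply: eq_bigr => i _; congr (_ * foldl _ _ _ i).
apply/funext => {}i; congr phi.
rewrite [RHS](reindex_inj (h := fun c => (c.1, tau c.1 c.2)))/=.
  apply: eq_bigr => -[j a] _ /=.
  by rewrite /onehot /= ffunE (inj_eq perm_inj).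
by move=> [j a] [j' a'] /= [->]; move/perm_inj => ->.
Qed.

(** By injectivity, perturbing coordinate [p] after relabelling is perturbing coordinate
    [relabel_params p] before it. *)
Lemma grad_relabel (F G : params R X k d L -> R) th p :
  (forall th', F (th' \o relabel_params) = G th') ->
  grad F (th \o relabel_params) p = grad G th (relabel_params p).
Proof.
move=> FG; rewrite /grad; congr (derive1 _ 0); apply/funext => h.
rewrite -FG; congr F; apply/funext => q /=.
by rewrite (inj_eq relabel_params_inj).
Qed.

Lemma sgd_relabel (phi : R -> R) eta xs ys (th : params R X k d L) t :
  sgd phi eta xs ys (th \o relabel_params) t =
  sgd phi eta (relabel_string \o xs) ys th t \o relabel_params.
Proof.
elim: t => [//|t IHt] /=; rewrite IHt; apply/funext => p /=.
congr (_ - _ * _); apply: grad_relabel => th' /=.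
by rewrite f_MLP_relabel.
Qed.

End Relabelling.

(** * Joint laws determined by independent coordinates *)

Section Cylinders.
Context {I : eqType} {Out : pointedType} (C : I -> set (set Out)).

(** [C i] stands for the events that depend on coordinate [i] of an outcome. Their finite
    intersections form the pi-system on which laws are compared. *)
Definition cylinders : set (set Out) :=
  [set A | exists (J : seq I) (F : I -> set Out), [/\ uniq J,
    forall i, i \in J -> C i (F i) & A = \bigcap_(i in [set i | i \in J]) F i]].

Hypothesis C_setT : forall i, C i setT.
Hypothesis C_setI : forall i A B, C i A -> C i B -> C i (A `&` B).

Lemma cylinders_setT : cylinders setT.
Proof.
exists [::], (fun=> setT); split=> //; apply/seteqP; split=> // o _ i.
Qed.

Lemma cylinder1 i A : C i A -> cylinders A.
Proof.
move=> CA; exists [:: i], (fun=> A); split=> //.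
  by move=> j; rewrite inE => /eqP ->.
apply/seteqP; split=> [u Au j _|u Au]; first exact: Au.
by apply: (Au i); rewrite /= inE.
Qed.

Lemma cylinders_setI : setI_closed cylinders.
Proof.
move=> _ _ [J [F [_ CF ->]]] [J' [F' [_ CF' ->]]].
(* Padding with [setT] outside the index list lets both families share the list [undup (J ++ J')];
   outside its own list a family is unconstrained. *)
pose ext (J : seq I) (F : I -> set Out) i := if i \in J then F i else setT.
exists (undup (J ++ J')), (fun i => ext J F i `&` ext J' F' i); split.
- exact: undup_uniq.
- by move=> i _; apply: C_setI; rewrite /ext; case: ifP => //;
    [exact: CF | exact: CF'].
- apply/seteqP; split=> [u [oF oF'] i _|u oFF'].
    split; rewrite /ext; case: ifPn => // iJ; [exact: oF|exact: oF'].
  split=> i /= iJ.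
    have := oFF' i; rewrite /= mem_undup mem_cat iJ /ext iJ => /(_ isT) [].
    by [].
  have := oFF' i; rewrite /= mem_undup mem_cat iJ orbT /ext iJ => /(_ isT) [].
  by [].
Qed.

Context {d : measure_display} {Omega : measurableType d} {R : realType}.
Variables (P : probability Omega R) (E : I -> set (set Omega)).
Variables (V V' : Omega -> Out) (pi : I -> I).
Hypothesis E_indep : mutually_independent P E.
Hypothesis pi_inv : involutive pi.
Hypothesis V_E : forall i A, C i A -> E i (V @^-1` A).
Hypothesis V'_E : forall i A, C i A -> E (pi i) (V' @^-1` A).
Hypothesis V_law : forall i A, C i A -> P (V @^-1` A) = P (V' @^-1` A).

(** Independence turns both probabilities into products over coordinates. Coordinate [i] of [V'] is
    driven by source [pi i], so reindexing by [pi] pairs factors that agree by [V_law]. *)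
Lemma independent_cylinder_law A : cylinders A -> P (V @^-1` A) = P (V' @^-1` A).
Proof.
move=> [J [F [uJ CF ->]]]; rewrite !preimage_bigcap.
have := E_indep J (fun i => V @^-1` F i) uJ.
move=> ->; last by move=> i iJ; exact/V_E/CF.
(* Independence needs the [i]-th event in [E i], so the intersection is indexed by sources instead
   of coordinates. *)
have -> : \bigcap_(i in [set i | i \in J]) V' @^-1` F i =
    \bigcap_(i in [set i | i \in map pi J]) V' @^-1` F (pi i).
  apply/seteqP; split=> o oF i /=.
    by move=> /mapP[j jJ ->]; rewrite pi_inv; exact: oF.
  by move=> iJ; rewrite -(pi_inv i); apply: oF => /=; rewrite map_f.
have := E_indep (map pi J) (fun i => V' @^-1` F (pi i)).
move=> ->.
- rewrite big_map; apply: eq_big_seq => i /CF CFi.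
  by rewrite pi_inv (V_law _ _ CFi).
- by rewrite map_inj_uniq//; exact: inv_inj.
- move=> i /mapP[j jJ ->]; rewrite pi_inv; exact/V'_E/CF.
Qed.

Hypothesis E_meas : forall i A, E i A -> measurable A.

Let measurable_into_cylinders (U : Omega -> Out) (rho : I -> I) :
  (forall i A, C i A -> E (rho i) (U @^-1` A)) ->
  measurable_fun setT (U : Omega -> g_sigma_algebraType cylinders).
Proof.
move=> UE; apply: (@measurability _ _ Omega (g_sigma_algebraType cylinders)
  setT U cylinders) => //.
move=> _ [_ [J [F [uJ CF ->]]] <-]; rewrite setTI preimage_bigcap.
apply: fin_bigcap_measurable => [|i iJ]; first exact: finite_seq.
exact: E_meas (UE _ _ (CF i iJ)).
Qed.

(** The push-forwards of [P] by [V] and [V'] agree on the cylinders, a generating pi-system, hence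
    are equal as measures and integrate [h] alike. *)
Lemma independent_integral_law (h : g_sigma_algebraType cylinders -> \bar R) :
  measurable_fun setT h -> (forall o, (0 <= h o)%E) ->
  (\int[P]_w h (V w) = \int[P]_w h (V' w))%E.
Proof.
move=> mh h0.
have mV := measurable_into_cylinders V idfun V_E.
have mV' := measurable_into_cylinders V' pi V'_E.
have toV U (mU : measurable_fun setT (U : Omega -> g_sigma_algebraType cylinders)) :
    (\int[P]_w h (U w) = \int[pushforward P U]_o h o)%E.
  by rewrite (ge0_integral_pushforward mU)// preimage_setT.
rewrite (toV _ mV) (toV _ mV').
apply: eq_measure_integral => A mA _.
apply: (@measure_unique _ R (g_sigma_algebraType cylinders) cylinders
  (fun=> setT)) => //.
- exact: cylinders_setI.
- by move=> _; exact: cylinders_setT.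
- by rewrite bigcup_const.
- exact: independent_cylinder_law.
- move=> _; change (P (V @^-1` setT) < +oo)%E.
  by rewrite preimage_setT probability_setT ltry.
Qed.

End Cylinders.

(** * Training strings almost surely use seen tokens only *)

Section SeenTokens.
Context {R : realType} {X W : finType} {k : nat}.
Variables (mu : template X W k -> R) (musub : template X W k -> submap X W -> R).
Hypotheses (mu_distr : is_distr mu) (musub_distr : is_sub_distrs mu musub).

(** [musub z] is known to be a distribution only on the support; off it the factor [mu z] is
    zero. *)
Lemma sample_mass_ge0 z s : 0 <= mu z * musub z s.
Proof.
have [mu_ge0 _] := mu_distr; have := mu_ge0 z; rewrite le_eqVlt => /predU1P[<-|mz].
  by rewrite mul0r.
by have [[musub_ge0 _] _] := musub_distr _ mz; rewrite mulr_ge0// ltW.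
Qed.

Lemma prob_x_ge0 x : 0 <= prob_x mu musub x.
Proof. by do 2 apply: sumr_ge0 => ? _; exact: sample_mass_ge0. Qed.

Lemma sum_prob_x : \sum_x prob_x mu musub x = 1.
Proof.
have [mu_ge0 <-] := mu_distr; rewrite exchange_big; apply: eq_bigr => z _ /=.
rewrite -[LHS](partition_big (sub z) predT (P := predT)
  (F := fun s => mu z * musub z s))//.
rewrite -mulr_sumr.
have := mu_ge0 z; rewrite le_eqVlt => /predU1P[<-|mz]; first by rewrite mul0r.
by have [[_ ->] _] := musub_distr _ mz; rewrite mulr1.
Qed.

(** If a full-mass set [S] missed a letter of [sub z s], this string would lie in a null set of
    strings. All nonnegative terms of its probability would then vanish, among them
    [mu z * musub z s]. *)
Lemma sub_in_X_seen z s : mu z * musub z s != 0 ->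
  forall i, sub z s i \in X_seen mu musub.
Proof.
move=> zs_neq0 i; rewrite inE; apply/forallP => S; apply/implyP => /eqP S_full.
apply: contraNT zs_neq0 => i_notin.
have := sum_prob_x.
rewrite (bigID (fun x : tstring X k => [forall i, x i \in S])) /=.
rewrite S_full => /(canRL (addKr _)); rewrite addNr.
move=> /psumr_eq0P-/(_ (fun x _ => prob_x_ge0 x)) /(_ (sub z s)).
have -> : ~~ [forall i, sub z s i \in S] by apply/forallPn; exists i.
move=> /(_ isT) /psumr_eq0P-/(_ _ z isT); rewrite /= => zs0.
have/psumr_eq0P : \sum_(s' | sub z s' == sub z s) mu z * musub z s' = 0.
  by apply: zs0 => ? _; apply: sumr_ge0 => ? _; exact: sample_mass_ge0.
by move=> /(_ (fun s' _ => sample_mass_ge0 z s') s) ->.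
Qed.

Context {d : measure_display} {Omega : measurableType d}.
Variables (P : probability Omega R) (zS : nat -> Omega -> template X W k)
  (sS : nat -> Omega -> submap X W).
Hypothesis mzs : forall n z s, measurable [set w | zS n w = z /\ sS n w = s].
Hypothesis Pzs : forall n z s,
  P [set w | zS n w = z /\ sS n w = s] = (mu z * musub z s)%:E.

Lemma samples_seen_ae :
  {ae P, forall w n i, sub (zS n w) (sS n w) i \in X_seen mu musub}.
Proof.
(* [F n m] is the event that step [n] draws the pair coded by [m], if that pair has mass zero, and
   is empty otherwise. The exceptional set is thus a countable union of null sets. *)
pose F n m : set Omega :=
  if unpickle m is Some q then
    if mu q.1 * musub q.1 q.2 == 0 then [set w | zS n w = q.1 /\ sS n w = q.2]
    else set0
  else set0.
apply: (@negligibleS _ _ _ _ (\bigcup_n \bigcup_m F n m)).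
  move=> w /= /existsNP[n] /existsNP[i] /negP unseen.
  exists n => //; exists (pickle (zS n w, sS n w)) => //.
  rewrite /F pickleK /=; case: ifPn => // /sub_in_X_seen /(_ i) seen.
  by rewrite seen in unseen.
apply: negligible_bigcup => n; apply: negligible_bigcup => m; rewrite /F.
case: (unpickle m) => [q|]; last exact: negligible_set0.
case: ifPn => [/eqP q0|_]; last exact: negligible_set0.
by apply/negligibleP; [exact: mzs|rewrite /= Pzs q0].
Qed.

End SeenTokens.

(** At most [k] wildcards occur in [z], so they fit injectively into [U]. The map [s0] only supplies
    [#|W| <= #|X|], which leaves room for the other wildcards. *)
Lemma exists_match_in {X W : finType} {k : nat} (z : template X W k)
    (s0 : submap X W) (U : {set X}) :
  all_wildcards z -> injective s0 -> (k <= #|U|)%N ->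
  exists x : tstring X k, (forall i, x i \in U) /\ matches x z.
Proof.
move=> zW s0_inj kU.
pose Wz := [set w : W | [exists i, z i == inr w]]%SET.
have Wz_le : (#|Wz| <= #|U|)%N.
  apply: leq_trans kU; pose g i := if z i is inr w then Some w else None.
  have SomeW_inj : injective (@Some W) by move=> ? ? [].
  rewrite -(card_imset _ SomeW_inj) -[leqRHS](card_ord k) -cardsT.
  apply: leq_trans (leq_imset_card g _); apply/subset_leq_card/fintype.subsetP.
  move=> _ /imsetP[w + ->]; rewrite inE => /existsP[i /eqP zi].
  by apply/imsetP; exists i; rewrite ?inE// /g zi.
(* Occurring wildcards are listed first, and so are the tokens of [U]. Matching the lists by index
   is injective and sends [Wz] into [U]; the default [s0 w] below is never reached. *)
pose l1 := enum Wz ++ enum (~: Wz); pose l2 := enum U ++ enum (~: U).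
have in_l1 w : w \in l1 by rewrite mem_cat !mem_enum finset.in_setC orbN.
have l2_uniq : uniq l2.
  rewrite cat_uniq !enum_uniq andbT /=; apply/hasPn => a.
  by rewrite !mem_enum finset.in_setC.
have l12 : (size l1 <= size l2)%N.
  rewrite !size_cat -!cardE !cardsC; exact: leq_card s0_inj.
have idx w : (index w l1 < size l2)%N.
  by apply: leq_trans l12; rewrite index_mem.
pose s : submap X W := [ffun w => nth (s0 w) l2 (index w l1)].
exists (sub z s); split.
  move=> i; rewrite ffunE; have [w zi] := zW i; rewrite zi ffunE.
  have w_in : w \in enum Wz.
    by rewrite mem_enum inE; apply/existsP; exists i; rewrite zi.
  have w_lt : (index w (enum Wz) < size (enum U))%N.
    by apply: leq_trans (_ : size (enum Wz) <= _)%N; rewrite ?index_mem// -!cardE.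
  by rewrite index_cat w_in nth_cat w_lt -mem_enum mem_nth.
exists s; split; last split=> // w; last first.
  by apply/existsPn => i; have [w' ->] := zW i.
move=> w w'; rewrite !ffunE (set_nth_default (s0 w))// => /eqP.
rewrite nth_uniq// => /eqP ww'.
by rewrite -(nth_index w (in_l1 w)) ww' nth_index.
Qed.

(** * Equality of the expected losses on unseen strings *)

Section LossInvariance.
Context {R : realType} {X W : finType} {k d L : nat}.
Variables (mu : template X W k -> R) (musub : template X W k -> submap X W -> R).
Variables (fstar : template X W k -> R) (phi : R -> R).
Hypotheses (mu_distr : is_distr mu) (musub_distr : is_sub_distrs mu musub).
Hypothesis phi_derivable : forall x : R, derivable phi x 1.
Context {dO : measure_display} {Omega : measurableType dO}.
Variables (P : probability Omega R).
Variables (th0 : pidx X k d L -> Omega -> R) (zS : nat -> Omega -> template X W k)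
  (sS : nat -> Omega -> submap X W) (xi : nat -> Omega -> R).
Hypothesis mth0 : forall p, measurable_fun setT (th0 p).
Hypothesis th0_law : forall p q B, param_block p = param_block q ->
  measurable B -> P (th0 p @^-1` B) = P (th0 q @^-1` B).
Hypothesis mzs : forall n z s, measurable [set w | zS n w = z /\ sS n w = s].
Hypothesis Pzs : forall n z s,
  P [set w | zS n w = z /\ sS n w = s] = (mu z * musub z s)%:E.
Hypothesis mxi : forall n, measurable_fun setT (xi n).

Let sources (i : (pidx X k d L + nat * bool)%type) : set (set Omega) :=
  match i with
  | inl p => events_of_real (th0 p)
  | inr (n, false) => events_of_fin (fun w => (zS n w, sS n w))
  | inr (n, true) => events_of_real (xi n)
  end.
Hypothesis sources_indep : mutually_independent P sources.
Variable eta : nat -> R.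

(** The loss is a deterministic function of initialisation, samples and noise, so that it can be
    evaluated on an abstract outcome. The target [b] is independent of the string [x]. *)
Definition sqerr (x : tstring X k) (b : R) (t : nat) (th : pidx X k d L -> R)
    (q : nat -> (template X W k * submap X W)%type) (e : nat -> R) : \bar R :=
  ((f_MLP phi x (sgd phi eta (fun n => sub (q n).1 (q n).2)
     (fun n => fstar (q n).1 + e n) th t) - b) ^+ 2)%:E.

(** The space [T] is arbitrary because the lemma serves both [Omega] and the space of outcomes with
    its cylinder sigma-algebra. *)
Lemma sqerr_measurable dT (T : measurableType dT) x b t
    (th : T -> pidx X k d L -> R)
    (q : T -> nat -> (template X W k * submap X W)%type) (e : T -> nat -> R) :
  (forall p, measurable_fun setT (th^~ p)) ->
  (forall n (S : {set template X W k * submap X W}),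
     measurable [set w | q w n \in S]) ->
  (forall n, measurable_fun setT (e^~ n)) ->
  measurable_fun setT (fun w => sqerr x b t (th w) (q w) (e w)).
Proof.
move=> mth mq me.
have mq_fun n (g : template X W k * submap X W -> R) :
    measurable_fun setT (fun w => g (q w n)).
  move=> _ B mB; rewrite setTI.
  rewrite (_ : _ @^-1` _ = [set w | q w n \in [set c | g c \in B]%SET]).
    exact: mq.
  apply/seteqP; split=> w /=; rewrite finset.in_set; first exact: mem_set.
  exact: set_mem.
apply/measurable_EFinP; apply: measurable_funX; apply: measurable_funB => //.
apply: (@f_MLP_measurable _ _ _ _ _ _ phi_derivable _ _ (fun=> x)
  (fun p w => sgd phi eta (fun n => sub (q w n).1 (q w n).2)
     (fun n => fstar (q w n).1 + e w n) (th w) t p)) => // p.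
apply: (@sgd_measurable _ _ _ _ _ _ phi_derivable _ _ eta
  (fun n w => sub (q w n).1 (q w n).2) (fun n w => fstar (q w n).1 + e w n)
  (fun p w => th w p)) => //.
- by move=> n c; exact: (mq_fun n (fun c' => onehot R (sub c'.1 c'.2) c)).
- move=> n; apply: measurable_funD => //.
  exact: (mq_fun n (fun c => fstar c.1)).
Qed.

Let mzs_set n (S : {set template X W k * submap X W}) :
  measurable [set w | (zS n w, sS n w) \in S].
Proof.
rewrite (_ : [set _ | _] = \bigcup_(q in [set` S])
    [set w | zS n w = q.1 /\ sS n w = q.2]).
  by apply: fin_bigcup_measurable => // q _; exact: mzs.
apply/seteqP; split=> [w wS|w [[z s] /= zsS [-> ->]]//].
by exists (zS n w, sS n w).
Qed.

Let source_measurable i A : sources i A -> measurable A.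
Proof.
case: i => [p|[n []]] /= [B]; last by move=> ->; exact: mzs_set.
- by move=> [mB ->]; rewrite -[X in measurable X]setTI; exact: mth0.
- by move=> [mB ->]; rewrite -[X in measurable X]setTI; exact: mxi.
Qed.

(* [tau j] exchanges the tokens [x1 j] and [x2 j]: this fixes the seen strings,
   preserves the law of the initialisation and commutes with the SGD dynamics,
   while it turns [x1] into [x2]. *)
Lemma unseen_loss_eq (x1 x2 : tstring X k) (b : R) (t : nat) :
  (forall i, x1 i \in X_uns mu musub) -> (forall i, x2 i \in X_uns mu musub) ->
  (\int[P]_w sqerr x1 b t (th0^~ w) (fun n => (zS n w, sS n w)) (xi^~ w) =
   \int[P]_w sqerr x2 b t (th0^~ w) (fun n => (zS n w, sS n w)) (xi^~ w))%E.
Proof.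
move=> x1_uns x2_uns.
pose tau j := tperm (x1 j) (x2 j).
pose rho := @relabel_params X k d L tau.
have rhoK : involutive rho by move=> [[[i [j a]]|[[l i] j]]|i] //=; rewrite tpermK.
pose sample := (template X W k * submap X W)%type.
pose outcome := ((pidx X k d L -> R) * (nat -> sample) * (nat -> R))%type.
(* [V] and [V'] differ only by [rho] on the initial weights. They have the same law, since the
   sources are independent and [rho] preserves each block of identically distributed weights. *)
pose V w : outcome := (th0^~ w, fun n => (zS n w, sS n w), xi^~ w).
pose V' w : outcome := ((th0^~ w) \o rho, fun n => (zS n w, sS n w), xi^~ w).
pose Out : pointedType := HB.pack outcome (isPointed.Build outcome (V point)).
pose C (i : (pidx X k d L + nat * bool)%type) : set (set Out) :=
  match i with
  | inl p => [set A | exists B, measurable B /\ A = [set o : outcome | B (o.1.1 p)]]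
  | inr (n, false) =>
      [set A | exists S : {set template X W k * submap X W},
         A = [set o : outcome | o.1.2 n \in S]]
  | inr (n, true) =>
      [set A | exists B, measurable B /\ A = [set o : outcome | B (o.2 n)]]
  end.
pose pi (i : (pidx X k d L + nat * bool)%type) :=
  if i is inl p then inl (rho p) else i.
have C_setT i : C i setT.
  case: i => [p|[n []]] /=; [exists setT; split=> //| exists setT; split=> //|].
  by exists finset.setT; apply/seteqP; split=> o //= _; rewrite inE.
have C_setI i A B : C i A -> C i B -> C i (A `&` B).
  case: i => [p|[n []]] /= [SA] + [SB].
  - by move=> [mA ->] [mB ->]; exists (SA `&` SB); split=> //; exact: measurableI.
  - by move=> [mA ->] [mB ->]; exists (SA `&` SB); split=> //; exact: measurableI.
  - move=> -> ->; exists (SA :&: SB)%SET.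
    by apply/seteqP; split=> o /=; rewrite finset.in_setI => /andP.
pose T := g_sigma_algebraType (cylinders C).
have mcyl i A : C i A -> measurable (A : set T).
  by move=> CA; apply: sub_sigma_algebra; exact: cylinder1 CA.
pose h (o : T) := sqerr x1 b t o.1.1 o.1.2 o.2.
have mh : measurable_fun setT h.
  apply: (@sqerr_measurable _ T x1 b t (fun o => o.1.1) (fun o => o.1.2)
    (fun o => o.2)).
  - move=> p _ B mB; rewrite setTI; apply: (mcyl (inl p)).
    by exists B.
  - move=> n S; apply: (mcyl (inr (n, false))).
    by exists S.
  - move=> n _ B mB; rewrite setTI; apply: (mcyl (inr (n, true))).
    by exists B.
have h_ge0 o : (0 <= h o)%E by rewrite lee_fin sqr_ge0.
have V_C i A : C i A -> sources i (V @^-1` A).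
  case: i => [p|[n []]] /= [B].
  - by move=> [mB ->]; exists B.
  - by move=> [mB ->]; exists B.
  - by move=> ->; exists B.
have V'_C i A : C i A -> sources (pi i) (V' @^-1` A).
  case: i => [p|[n []]] /= [B].
  - by move=> [mB ->]; exists B.
  - by move=> [mB ->]; exists B.
  - by move=> ->; exists B.
have V_law i A : C i A -> P (V @^-1` A) = P (V' @^-1` A).
  case: i => [p|[n []]] /= [B].
  - move=> [mB ->]; apply: (th0_law p (rho p)) => //.
    by rewrite relabel_params_block.
  - by move=> [mB ->].
  - by move=> ->.
have piK : involutive pi by move=> [p|[n []]] //=; rewrite rhoK.
have := independent_integral_law C C_setT C_setI P sources V V' pi sources_indep
  piK V_C V'_C V_law source_measurable h mh h_ge0.
(* Equality in law puts [rho] into the initialisation; what remains is an almost sure identity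
   between the two losses. *)
rewrite /h /V /= => ->.
apply: ge0_ae_eq_integral => //.
- apply: (@sqerr_measurable _ _ x1 b t (fun w => (th0^~ w) \o rho)
    (fun w n => (zS n w, sS n w)) (fun w => xi^~ w)) => // p.
  exact: mth0.
- exact: (@sqerr_measurable _ _ x2 b t (fun w => th0^~ w)
    (fun w n => (zS n w, sS n w)) (fun w => xi^~ w)).
- by move=> w _; rewrite lee_fin sqr_ge0.
- by move=> w _; rewrite lee_fin sqr_ge0.
have := samples_seen_ae mu musub mu_distr musub_distr P zS sS mzs Pzs.
apply: filterS => w w_seen _.
(* The permutation moves from the initial weights to the training strings and the test string. It
   turns [x1] into [x2], and it fixes each training token, which is seen and so differs from both
   [x1 j] and [x2 j]. *)
rewrite /sqerr /= sgd_relabel f_MLP_relabel.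
congr ((f_MLP _ _ (sgd _ _ _ _ _ _) - _) ^+ 2)%:E.
  by apply/ffunP => j; rewrite ffunE tpermL.
apply/funext => n; apply/ffunP => j /=; rewrite ffunE tpermD//.
  by apply: contraTneq (x1_uns j) => ->; rewrite finset.in_setC negbK.
by apply: contraTneq (x2_uns j) => ->; rewrite finset.in_setC negbK.
Qed.

Lemma sqerr_measurable_sample x b t : measurable_fun setT
  (fun w => sqerr x b t (th0^~ w) (fun n => (zS n w, sS n w)) (xi^~ w)).
Proof.
exact: (@sqerr_measurable _ _ x b t (fun w => th0^~ w)
  (fun w n => (zS n w, sS n w)) (fun w => xi^~ w)).
Qed.

End LossInvariance.

(** * The lower bound from two conflicting labels *)

Lemma sqr_dist_le {R : realFieldType} (y a b : R) :
  (a - b) ^+ 2 / 2 <= (y - a) ^+ 2 + (y - b) ^+ 2.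
Proof.
rewrite ler_pdivrMr// -subr_ge0.
rewrite (_ : _ - _ = (2 * y - a - b) ^+ 2) ?sqr_ge0//.
ring.
Qed.

Theorem mainTheorem16 (R : realType) (X W : finType) (k : nat)
  (mu : template X W k -> R) (fstar : template X W k -> R) :
  is_distr mu ->
  (forall z, in_supp mu z -> all_wildcards z) ->
  (exists z1 z2, in_supp mu z1 /\ in_supp mu z2 /\ fstar z1 <> fstar z2) ->
  exists c : R, 0 < c /\
  forall (musub : template X W k -> submap X W -> R) (sigma : R),
    is_sub_distrs mu musub -> 0 <= sigma ->
    (k <= #|X_uns mu musub|)%N ->
  forall (L d : nat) (phi : R -> R),
    (0 < L)%N -> (forall x : R, derivable phi x 1) ->
  forall (m0 s0 : nat -> R), (forall b, 0 < s0 b) ->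
  forall (dO : measure_display) (Omega : measurableType dO)
    (P : probability Omega R)
    (th0 : pidx X k d L -> Omega -> R)
    (zS : nat -> Omega -> template X W k) (sS : nat -> Omega -> submap X W)
    (xi : nat -> Omega -> R),
    (forall p, measurable_fun setT (th0 p)) ->
    (forall p B, measurable B ->
       P (th0 p @^-1` B) = gauss_law (m0 (param_block p)) (s0 (param_block p)) B) ->
    (forall n z s, measurable [set w | zS n w = z /\ sS n w = s]) ->
    (forall n z s, P [set w | zS n w = z /\ sS n w = s] = (mu z * musub z s)%:E) ->
    (forall n, measurable_fun setT (xi n)) ->
    (forall n B, measurable B -> P (xi n @^-1` B) = gauss_law 0 sigma B) ->
    mutually_independent P
      (fun i : (pidx X k d L + nat * bool)%type =>
         match i with
         | inl p => events_of_real (th0 p)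
         | inr (n, false) => events_of_fin (fun w => (zS n w, sS n w))
         | inr (n, true) => events_of_real (xi n)
         end) ->
  forall (eta : nat -> R) (t : nat), (forall n, 0 < eta n) ->
  exists x : tstring X k, (forall i, x i \in X_uns mu musub) /\
    exists z, in_supp mu z /\ matches x z /\
      (c%:E <= \int[P]_w
         ((f_MLP phi x
             (sgd phi eta (fun n => sub (zS n w) (sS n w))
                  (fun n => fstar (zS n w) + xi n w) (fun p => th0 p w) t)
           - fstar z) ^+ 2)%:E)%E.
Proof.
move=> mu_distr mu_wild [z1 [z2 [z1_supp [z2_supp f12]]]].
(* Two losses against the two labels add up to at least [(fstar z1 - fstar z2) ^+ 2 / 2]; [c] is
   half of this. *)
pose c := (fstar z1 - fstar z2) ^+ 2 / 4.
have c_gt0 : 0 < c.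
  by rewrite divr_gt0// exprn_even_gt0//= subr_eq0; apply/eqP.
exists c; split=> // musub sigma musub_distr _ kU L d phi _ phi_derivable m0 s0 _.
move=> dO Omega P th0 zS sS xi mth0 th0_gauss mzs Pzs mxi _ indep eta t _.
have th0_law p q B : param_block p = param_block q -> measurable B ->
    P (th0 p @^-1` B) = P (th0 q @^-1` B).
  move=> pq mB; have := th0_gauss p _ mB; rewrite pq => ->.
  exact: esym (th0_gauss q _ mB).
(* Since [musub z1] has total mass one, some substitution map has positive mass and is therefore
   injective. *)
have [s0' s0'_inj] : exists s : submap X W, injective s.
  have [[musub_ge0 musub1] musub_inj] := musub_distr _ z1_supp.
  have : \sum_s musub z1 s != 0 by rewrite musub1 oner_neq0.
  rewrite psumr_neq0 => [/hasP[s _ /andP[_ /musub_inj s_inj]]|s _].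
    by exists s.
  exact: musub_ge0.
have [x1 [x1_uns x1z1]] := exists_match_in z1 s0' _ (mu_wild _ z1_supp) s0'_inj kU.
have [x2 [x2_uns x2z2]] := exists_match_in z2 s0' _ (mu_wild _ z2_supp) s0'_inj kU.
pose err x b := (\int[P]_w ((f_MLP phi x
  (sgd phi eta (fun n => sub (zS n w) (sS n w))
    (fun n => (fstar (zS n w) + xi n w)%R) (fun p => th0 p w) t) - b) ^+ 2)%:E)%E.
(* If [x1] fails, its loss against [fstar z1] is below [c], and so is that of [x2] against the same
   label. The loss of [x2] against [fstar z2] must then be at least [c]. *)
have [c_le|lt_c] := leP c%:E (err x1 (fstar z1)).
  by exists x1; split=> //; exists z1.
exists x2; split=> //; exists z2; split=> //; split=> //.
rewrite leNgt; apply/negP => lt_c'.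
have err_eq : err x1 (fstar z1) = err x2 (fstar z1).
  exact: (unseen_loss_eq mu musub fstar phi mu_distr musub_distr phi_derivable
    P th0 zS sS xi mth0 th0_law mzs Pzs mxi indep eta).
have merr b := sqerr_measurable_sample fstar phi phi_derivable
  th0 zS sS xi mth0 mzs mxi eta x2 b t.
(* Both errors concern the same string [x2], so the quadratic inequality holds pointwise and is
   integrated against total mass one. *)
have : ((c + c)%:E <= err x2 (fstar z1) + err x2 (fstar z2))%E.
  rewrite -ge0_integralD//.
  - have -> : (c + c)%:E = (\int[P]_w cst (c + c)%:E w)%E.
      rewrite integral_cst// -[LHS]mule1; congr (_ * _)%E.
      exact/esym/probability_setT.
    apply: ge0_le_integral => //.
    + by move=> w _; rewrite lee_fin addr_ge0// ltW.
    + by apply: emeasurable_funD; exact: merr.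
    + move=> w _; rewrite -EFinD lee_fin.
      apply: le_trans (sqr_dist_le _ _ _); rewrite /c -mulrDr.
      by rewrite le_eqVlt; apply/orP; left; apply/eqP; congr (_ * _); field.
  - by move=> w _; rewrite lee_fin sqr_ge0.
  - exact: merr.
  - by move=> w _; rewrite lee_fin sqr_ge0.
  - exact: merr.
apply/negP; rewrite -ltNge -err_eq EFinD; exact: lteD.
Qed.
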